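(* Let $q\ge 2$ and $1\le r<q$ be coprime integers. Then, as an identity in $\mathbb{Z}[z]$, $$\operatorname{Res}_x\!\left(F(z)x^q-1,\ \widetilde B_z(x)\right)=(-1)^{(q-1)(q-2)/2}\,\mathcal{D}_{r,q}(z)\prod_{i=0}^{q-1}V_i(z).$$
   Context: For coprime integers $q\ge2$, $1\le r<q$, let $c_i = ir \bmod q\in\{0,\dots,q-1\}$ for every integer $i$ (so $c_i$ is $q$-periodic in $i$). Empty products equal $1$. Define $$\mathcal{D}_{r,q}(z)=\det\left[\prod_{m=0}^{j-1}(z+c_{i+m})\right]_{0\le i,j\le q-1},$$ $$V_0(z)=1,\qquad V_i(z)=\prod_{m=0}^{i-1}(z+c_m)\quad(1\le i\le q),$$ $$F(z)=V_q(z)=\prod_{a=0}^{q-1}(z+a),\qquad \widetilde B_z(x)=\sum_{i=0}^{q-1}V_i(z)x^i.$$ $\operatorname{Res}_x$ is the resultant with respect to $x$ of polynomials of degrees $q$ and $q-1$ in $x$ with coefficients in $\mathbb{Z}[z]$, normalized so that $\operatorname{Res}_x(A,B)=\operatorname{lc}(A)^{\deg B}\prod_{A(\xi)=0}B(\xi)$ (roots counted with multiplicity). *)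

(* Defs.v *)
From mathcomp Require Import all_boot all_order all_algebra.
From mathcomp Require Import zify.

Set Implicit Arguments.
Unset Strict Implicit.
Unset Printing Implicit Defensive.

Import GRing.Theory.
Local Open Scope ring_scope.

(* MathComp's [resultant] lists coefficients by increasing degree in the
   Sylvester matrix, so it differs by the factor (-1)^(deg A * deg B) from the
   resultant normalized by
     Res(A, B) = lc(A)^(deg B) * \prod_(A(xi) = 0) B(xi),
   which is [Res] below; the normalization is proved in [ResE]. *)
Definition Res (R : nzRingType) (A B : {poly R}) : R :=
  (-1) ^+ ((size A).-1 * (size B).-1) * resultant A B.

(* Sylvester matrix with formal dimensions: n rows for p, N - n rows for q. *)
Definition sylv (R : nzRingType) (N n : nat) (p q : {poly R}) : 'M[R]_N :=
  \matrix_(i, k) (if (i < n)%N then 'X^i * p else 'X^(i - n) * q)`_k.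

Lemma resultant_sylv (R : nzRingType) (p q : {poly R}) :
  resultant p q = \det (sylv ((size q).-1 + (size p).-1) (size q).-1 p q).
Proof.
rewrite /resultant; congr (\det _); apply/matrixP => i k.
rewrite Sylvester_mxE /sylv mxE.
case: splitP => j ->; rewrite ?ltn_ord ?ltnNge ?leq_addr /= ?addKn coefXnM.
  by case: ltnP.
by case: ltnP.
Qed.

Lemma sylv_map (R S : nzRingType) (f : {rmorphism R -> S}) N n p q :
  map_mx f (sylv N n p q) = sylv N n (map_poly f p) (map_poly f q).
Proof.
apply/matrixP => i k; rewrite !mxE.
by case: ifP => _; rewrite -(map_polyXn f) -rmorphM coef_map.
Qed.

Lemma sum_delta (R : nzRingType) N (t : nat) (g : nat -> R) :
  \sum_(j < N) g j *+ (t == j) = g t *+ (t < N)%N.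
Proof.
have [lt_tN | le_Nt] := ltnP t N.
  rewrite (bigD1 (Ordinal lt_tN)) // big1 => [|j /eqP ne_j].
    by rewrite /= eqxx addr0.
  by case: eqP => // Dt; case: ne_j; apply: val_inj.
rewrite big1 // => j _; case: eqP => // Dt.
by rewrite Dt leqNgt ltn_ord in le_Nt.
Qed.

Lemma det_sylv_XsubC (R : comNzRingType) (m n : nat) (a : R) (p q : {poly R}) :
    (size p <= m.+1)%N -> (size q <= n.+1)%N ->
  \det (sylv (n + m).+1 n (('X - a%:P) * p) q) =
    (-1) ^+ n * q.[a] * \det (sylv (n + m) n p q).
Proof.
move=> sz_p sz_q.
have [h Dh] : exists h, ('X - a%:P) * h = q - q.[a]%:P.
  have /factor_theorem[h Dh] : root (q - q.[a]%:P) a.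
    by rewrite /root !hornerE subrr.
  by exists h; rewrite mulrC -Dh.
pose N := (n + m).+1.
pose f (i : nat) := if (i < n)%N then 'X * ('X^i * p) else
  if i == n then q.[a]%:P + 'X * h else 'X * ('X^(i - n.+1) * q).
pose M : 'M[R]_N := \matrix_(i, k) (f i)`_k.
pose C : 'M[R]_N := \matrix_(i, k) ((k == i :> nat)%:R - a *+ (k.+1 == i)).
pose L : 'M[R]_N :=
  \matrix_(i, k) ((i == k :> nat)%:R - (a *+ (n < i)%N) *+ (i.-1 == k)).
have detC : \det C = 1.
  rewrite det_trig; last first.
    apply/is_trig_mxP => i j lt_ij; rewrite mxE; do 2?[case: eqP => [|_]]; try lia.
    by rewrite subrr.
  by rewrite big1 // => i _; rewrite mxE eqxx; case: eqP; rewrite ?subr0 //; lia.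
have detL : \det L = 1.
  rewrite det_trig; last first.
    apply/is_trig_mxP => i j lt_ij; rewrite mxE; do 2?[case: eqP => [|_]]; try lia.
    by rewrite subrr.
  rewrite big1 // => i _; rewrite mxE eqxx; case: eqP; rewrite ?subr0 //.
  by case: ltnP; rewrite ?subr0 //; lia.
have sz_h : (size h <= n)%N.
  have [-> | nz_h] := eqVneq h 0; first by rewrite size_poly0.
  have := size_monicM (monicXsubC a) nz_h; rewrite Dh size_XsubC /= => sz.
  have: (size (q - q.[a]%:P)%R <= n.+1)%N.
    rewrite (leq_trans (size_polyD _ _)) // geq_max sz_q size_polyN.
    by rewrite (leq_trans (size_polyC_leq1 _)).
  by rewrite sz.
have szX (g : {poly R}) k : (size g <= k)%N -> g`_k = 0.
  by move/leq_sizeP; apply.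
have fN i : (i < N)%N -> (f i)`_N = 0.
  rewrite /N => lt_iN; rewrite /f; case: ltnP => [lt_in | le_ni].
    rewrite coefXM /= coefXnM; case: ltnP => // _; apply: szX; move: sz_p sz_q; lia.
  case: eqP => [_ | ne_in]; rewrite ?coefD ?coefC coefXM /=.
    by rewrite add0r szX // (leq_trans sz_h) ?leq_addr.
  rewrite coefXnM; case: ltnP => // _; apply: szX; move: sz_p sz_q; lia.
have fS i k : (f i)`_k - a * (f i)`_k.+1 =
  (if (i < n)%N then 'X^i * (('X - a%:P) * p) else if i == n then q
   else ('X - a%:P) * ('X^(i - n.+1) * q))`_k.
  have coefXsubC (g : {poly R}) :
      ('X * g)`_k - a * ('X * g)`_k.+1 = (('X - a%:P) * g)`_k.
    by rewrite mulrBl coefB coefCM [('X * g)`_k.+1]coefXM.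
  rewrite /f; case: ifP => _; last case: ifP => _; rewrite ?coefXsubC //.
    by rewrite mulrCA.
  rewrite !coefD !mulrDr opprD addrACA coefXsubC Dh coefB coefC /=.
  by rewrite coefC /= mulr0 subr0 addrC subrK.
have LS : L *m sylv N n (('X - a%:P) * p) q = M *m C.
  apply/matrixP => i k; rewrite [LHS]mxE [RHS]mxE.
  pose S (j : nat) := (if (j < n)%N then 'X^j * (('X - a%:P) * p)
                       else 'X^(j - n) * q)`_k.
  transitivity (S i - a *+ (n < i)%N * S i.-1).
    transitivity (\sum_(j < N) S j *+ (i == j :> nat)
                  - a *+ (n < i)%N * \sum_(j < N) S j *+ (i.-1 == j)).
      rewrite mulr_sumr -sumrB; apply: eq_bigr => j _; rewrite !mxE -/(S j).
      by rewrite mulrBl mulr_natl mulrnAl mulrnAr.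
    rewrite !sum_delta ltn_ord; have -> // : (i.-1 < N)%N.
    by rewrite (leq_ltn_trans (leq_pred i)).
  transitivity ((f i)`_k - a * (f i)`_k.+1).
    rewrite fS /S; case: (ltngtP i n) => [lt_in | lt_ni | ->] /=.
    + by rewrite mul0r subr0.
    + have -> : (i.-1 < n)%N = false by lia.
      have -> : (i - n = (i.-1 - n).+1)%N by lia.
      have -> : (i - n.+1 = i.-1 - n)%N by lia.
      by rewrite mulr1n exprS -mulrA mulrBl coefB coefCM.
    + by rewrite mul0r subr0 subnn mul1r.
  transitivity (\sum_(j < N) (f i)`_j *+ (k == j :> nat)
                - a * \sum_(j < N) (f i)`_j *+ (k.+1 == j)).
    rewrite !sum_delta ltn_ord mulr1n; case: (ltnP k.+1 N) => //= le_Nk.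
    have -> : k.+1 = N by have := ltn_ord k; lia.
    by rewrite fN.
  rewrite mulr_sumr -sumrB; apply: eq_bigr => j _; rewrite !mxE.
  by rewrite mulrBr mulr_natr mulrnAr mulrnAr [a * _]mulrC.
have detM : \det M = (-1) ^+ n * q.[a] * \det (sylv (n + m) n p q).
  have lt_nN : (n < N)%N by rewrite ltnS leq_addr.
  rewrite (expand_det_col M ord0) (bigD1 (Ordinal lt_nN)) //= big1 => [|i ne_in].
    rewrite addr0 mxE /f /= ltnn eqxx coefD coefC coefXM /= addr0.
    rewrite /cofactor addn0 mulrCA mulrA; congr (_ * \det _).
    apply/matrixP => i k; rewrite !mxE /= /f /bump.
    case: (leqP n i) => [le_ni | lt_in] /=; last by rewrite lt_in coefXM.
    have -> : (1 + i < n)%N = false by lia.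
    have -> : (1 + i == n)%N = false by lia.
    by rewrite coefXM.
  rewrite mxE /f -val_eqE /= in ne_in *; rewrite (negPf ne_in).
  by case: ifP => _; rewrite coefXM mul0r.
by rewrite -detM -[LHS]mul1r -detL -det_mulmx LS det_mulmx detC mulr1.
Qed.

(* The product formula over any field K containing the coefficients in which A
   splits, with s the roots of A listed with multiplicity. *)
Lemma ResE (R : idomainType) (K : fieldType) (f : {rmorphism R -> K})
    (A B : {poly R}) (s : seq K) :
    injective f -> A != 0 ->
    map_poly f A = f (lead_coef A) *: \prod_(xi <- s) ('X - xi%:P) ->
  f (Res A B) = f (lead_coef A) ^+ (size B).-1
                * \prod_(xi <- s) (map_poly f B).[xi].
Proof.
move=> f_inj nz_A DA.
have nz_fA : f (lead_coef A) != 0 by rewrite raddf_eq0 // lead_coef_eq0.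
rewrite /Res resultant_sylv rmorphM rmorphXn rmorphN1 -det_map_mx sylv_map.
have szA : size A = (size s).+1.
  rewrite -(size_map_inj_poly f_inj) ?rmorph0 // DA size_scale //.
  by rewrite size_prod_XsubC.
have: (size (map_poly f B) <= (size B).-1.+1)%N.
  by rewrite (leq_trans (size_poly _ _)) ?leqSpred.
rewrite szA DA /=; move: (map_poly f B) (size B).-1 (f _) => q n c sz_q {DA szA}.
elim: s => [|a s IHs] /=.
  rewrite !big_nil mul0n mul1r mulr1 det_trig => [|]; last first.
    apply/is_trig_mxP => i j lt_ij; rewrite mxE.
    have -> : (i < n)%N by have := ltn_ord i; lia.
    by rewrite coefXnM ltnNge ltnW //= alg_polyC coefC subn_eq0 leqNgt lt_ij.
  rewrite (eq_bigr (fun=> c)) ?prodr_const ?card_ord ?addn0 // => i _.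
  have lt_in : (i < n)%N by have := ltn_ord i; lia.
  by rewrite mxE lt_in coefXnM ltnn subnn alg_polyC coefC.
rewrite !big_cons scalerAr addnS det_sylv_XsubC //; last first.
  by rewrite (leq_trans (size_scale_leq _ _)) // size_prod_XsubC.
rewrite mulSn exprD [RHS]mulrCA -IHs mulrAC -!mulrA mulrA -exprD addnn.
by rewrite -signr_odd odd_double mul1r [X in _ * X]mulrC.
Qed.

(* The integer i only ever occurs as a sum of indices >= 0, hence i : nat. *)
Definition c (r q i : nat) : nat := (i * r) %% q.

(* {poly int} is Z[z], with z = 'X. *)
Definition D (r q : nat) : {poly int} :=
  \det (\matrix_(i < q, j < q) \prod_(m < j) ('X + (c r q (i + m))%:R)).

Definition V (r q i : nat) : {poly int} := \prod_(m < i) ('X + (c r q m)%:R).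

Definition F (r q : nat) : {poly int} := V r q q.

Lemma F_prod (r q : nat) :
  coprime q r -> F r q = \prod_(a < q) ('X + (a : nat)%:R).
Proof.
case: q => [|q] cop_qr; first by rewrite /F /V !big_ord0.
pose h (m : 'I_q.+1) : 'I_q.+1 := inord (c r q.+1 m).
have hE m : h m = c r q.+1 m :> nat by rewrite inordK // ltn_mod.
rewrite [RHS](reindex h) /=; first by apply: eq_bigr => m _; rewrite hE.
apply/onW_bij/injF_bij => m1 m2 /(congr1 val) /=; rewrite !hE /c => eq_m.
apply: val_inj => /=; wlog le_m : m1 m2 eq_m / (m1 <= m2)%N.
  by move=> IH; case/orP: (leq_total m1 m2) => le_m; [|apply: esym]; apply: IH.
move/esym/eqP: eq_m; rewrite eqn_mod_dvd ?leq_mul2r ?le_m ?orbT //.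
rewrite -mulnBl Gauss_dvdl // => dvd_q; apply/eqP; rewrite eqn_leq le_m /=.
rewrite -subn_eq0; apply: contraTT dvd_q => ne_m.
by rewrite gtnNdvd ?lt0n // (leq_ltn_trans (leq_subr _ _)).
Qed.

(* {poly {poly int}} is Z[z][x], the outer variable being x. *)
Definition Btilde (r q : nat) : {poly {poly int}} := \poly_(i < q) V r q i.

(* Main.v *)
Require Import Defs.
From mathcomp Require Import all_boot all_order all_algebra.
From mathcomp Require Import zify.

Set Implicit Arguments.
Unset Strict Implicit.
Unset Printing Implicit Defensive.

Import GRing.Theory.
Local Open Scope ring_scope.

(* Extend V_k to all k >= 0; then V_(q+k) = F V_k.  In the Sylvester matrix of
   F x^q - 1 and Btilde, adding F times column k to column q + k for k < q - 1
   turns the rows of F x^q - 1 into (-1 | 0), and the remaining block becomes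
   the Hankel matrix [V_(i+j)] with its rows in reverse order.  Finally, row i
   of [V_(i+j)] is V_i times row i of the matrix defining D. *)

(** Reversing rows is left multiplication by the antidiagonal permutation matrix [J]. *)
Lemma det_row_rev (R : comNzRingType) (n : nat) (A : 'M[R]_n) :
  \det (\matrix_(i, j) A (rev_ord i) j) = (-1) ^+ 'C(n, 2) * \det A.
Proof.
pose J m : 'M[R]_m := \matrix_(i, j) (j == rev_ord i)%:R.
have detJ m : \det (J m) = (-1) ^+ 'C(m, 2).
  elim: m => [|m IHm]; first by rewrite det_mx00.
  (* The only nonzero entry of row 0 is in column [m]: it gives the sign [(-1)^m] and leaves the
     minor [J m]; then [C(m+1,2) = C(m,2) + m]. *)
  rewrite (expand_det_row _ ord0) (bigD1 ord_max) //= big1 => [|j ne_j].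
    rewrite mxE addr0 [_ == _](_ : _ = true) ?mul1r; last first.
      by apply/eqP/val_inj; rewrite /= subn1.
    rewrite /cofactor add0n binS bin1 addnC exprD -IHm; congr (_ * \det _).
    apply/matrixP => i j; rewrite !mxE; congr (nat_of_bool _)%:R.
    by rewrite -!val_eqE /= /bump; have := ltn_ord i; have := ltn_ord j; lia.
  rewrite mxE [_ == _](_ : _ = false) ?mul0r //.
  by apply: contra_neqF ne_j => /eqP->; apply: val_inj; rewrite /= subn1.
rewrite -detJ -det_mulmx; congr (\det _); apply/matrixP => i j.
rewrite !mxE (bigD1 (rev_ord i)) //= big1 => [|k ne_k].
  by rewrite mxE eqxx mul1r addr0.
by rewrite mxE (negPf ne_k) mul0r.
Qed.

Lemma det_sylv_Hankel (R : comNzRingType) (n : nat) (a : R) (v : nat -> R) :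
    (forall k, v (n.+1 + k)%N = a * v k) ->
  \det (sylv (n + n.+1) n (a *: 'X^(n.+1) - 1) (\poly_(i < n.+1) v i)) =
    (-1) ^+ (n + 'C(n.+1, 2)) * \det (\matrix_(i < n.+1, j < n.+1) v (i + j)%N).
Proof.
move=> v_per; set M := sylv _ _ _ _.
(* The right block starts at column [n], one before column [n+1], hence the shift [k.+1 == l]; its
   column 0 receives nothing. *)
pose W : 'M[R]_(n, n.+1) := \matrix_(k, l) (a *+ (k.+1 == l)).
have MulE : ulsubmx M = (-1)%:M.
  apply/matrixP => i k; rewrite !mxE /= ltn_ord coefXnM coefB coefZ coefXn coef1.
  rewrite -val_eqE /=; have lt_kn := ltn_ord k.
  case: (ltnP k i) => [lt_ki | le_ik]; first by case: eqP => //; lia.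
  have -> : (k - i == n.+1)%N = false by lia.
  have -> : (k - i == 0)%N = (i == k :> nat) by lia.
  by rewrite mulr0 sub0r mulNrn.
have MurE : ursubmx M = W.
  apply/matrixP => i l; rewrite !mxE /= ltn_ord coefXnM coefB coefZ coefXn coef1.
  have := ltn_ord i; have -> : (n + l < i)%N = false by have := ltn_ord i; lia.
  have -> : (n + l - i == 0)%N = false by have := ltn_ord i; lia.
  have -> : (n + l - i == n.+1)%N = (i.+1 == l :> nat).
    by have := ltn_ord i; lia.
  by rewrite subr0 mulr_natr.
pose U : 'M[R]_(n + n.+1) := block_mx 1%:M W 0 1%:M.
have detU : \det U = 1 by rewrite det_ublock !det1 mulr1.
(* Right multiplication by [U] performs the column operations; the upper right block becomes
   [-W + W = 0]. *)
rewrite -[LHS]mulr1 -[X in _ * X]detU -det_mulmx -[M]submxK MulE MurE mulmx_block.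
rewrite !mulmx1 !mulmx0 !addr0 mul_scalar_mx scaleN1r addNr det_lblock.
rewrite det_scalar exprD -mulrA -det_row_rev; congr (_ * \det _).
apply/matrixP => i l; rewrite [LHS]mxE !mxE /=.
have lt_in := ltn_ord i; have lt_ln := ltn_ord l.
under eq_bigr => k _ do rewrite !mxE /= ltnNge leq_addr addKn /= mulrnAr.
rewrite ltnNge leq_addr addKn /= !coefXnM !coef_poly.
case: (nat_of_ord l) lt_ln => [|l'] lt_ln.
  rewrite big1 ?add0r => [|k _]; last by rewrite mulr0n.
  have -> : (n + 0 < i)%N = false by lia.
  have -> : (n + 0 - i < n.+1)%N by lia.
  by congr v; lia.
under eq_bigr => k _ do rewrite coefXnM coef_poly eqSS eq_sym.
rewrite (sum_delta n l' (fun k => (if (k < i)%N then 0 else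
  if (k - i < n.+1)%N then v (k - i)%N else 0) * a)).
have -> : (l' < n)%N by [].
rewrite mulr1n.
have -> : (n + l'.+1 < i)%N = false by lia.
(* Exactly one summand survives: the original entry if [l' < i], otherwise the added
   [a * v (l' - i)], which [v_per] turns into [v (n+1+l'-i)]. *)
have [lt_l'i | le_il'] := ltnP l' i.
  have -> : (n + l'.+1 - i < n.+1)%N by lia.
  by rewrite mul0r add0r; congr v; lia.
have -> : (n + l'.+1 - i < n.+1)%N = false by lia.
have -> : (l' - i < n.+1)%N by lia.
by rewrite addr0 mulrC -v_per; congr v; lia.
Qed.

Lemma V_add (r q i j : nat) :
  V r q (i + j) = V r q i * \prod_(m < j) ('X + (c r q (i + m))%:R).
Proof. by rewrite /V big_split_ord. Qed.

Lemma V_period (r q k : nat) : V r q (q + k) = F r q * V r q k.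
Proof.
rewrite V_add; congr (_ * _); apply: eq_bigr => m _.
by rewrite /c mulnDl mulnC modnMDl.
Qed.

(** This fixes the actual degrees of both polynomials, on which [Res] and the Sylvester matrix
    depend. *)
Lemma V_neq0 (r q k : nat) : V r q k != 0.
Proof.
apply/monic_neq0/monic_prod => m _.
by rewrite -[_%:R]opprK -polyC_natr -polyCN monicXsubC.
Qed.

Lemma det_V_Hankel (r q : nat) :
  \det (\matrix_(i < q, j < q) V r q (i + j)) = \prod_(i < q) V r q i * D r q.
Proof.
transitivity (\det (diag_mx (\row_(i < q) V r q i)) * D r q); last first.
  by rewrite det_diag; congr (_ * _); apply: eq_bigr => i _; rewrite mxE.
rewrite -det_mulmx; congr (\det _).
by apply/matrixP => i j; rewrite mul_diag_mx !mxE V_add.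
Qed.

Theorem theorem3 (q r : nat) (hq : (2 <= q)%N) (hr1 : (1 <= r)%N)
    (hrq : (r < q)%N) (hqr : coprime q r) :
  Res (F r q *: 'X^q - 1) (Btilde r q) =
    (-1) ^+ ((q - 1) * (q - 2) %/ 2) * D r q * \prod_(i < q) V r q i.
Proof.
case: q => // n in hq hrq hqr *.
have szA : size (F r n.+1 *: 'X^(n.+1) - 1) = n.+2.
  have szF : size (F r n.+1 *: 'X^(n.+1)) = n.+2.
    by rewrite size_scale ?size_polyXn ?V_neq0.
  by rewrite size_polyDl ?szF // size_polyN size_poly1.
have szB : size (Btilde r n.+1) = n.+1 by rewrite size_poly_eq ?V_neq0.
rewrite /Res resultant_sylv szA szB /= (det_sylv_Hankel (V_period r n.+1)).
rewrite det_V_Hankel mulrA -exprD [_ * D _ _]mulrC mulrA; congr (_ * _ * _).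
(* With [n = q - 1], the left exponent is [(n+1)n + n + C(n+1,2)]. Since [(n+1)n] is even and
   [C(n+1,2) = n + C(n,2)], it has the parity of [C(n,2)]. *)
rewrite -signr_odd -[RHS]signr_odd; congr (_ ^+ nat_of_bool _).
case: n hq {hrq hqr szA szB} => // n _.
rewrite subn1 subn2 /= divn2 -(bin2 n.+1) !binS bin0 bin1.
by rewrite !oddD oddM /=; do 2?[case: odd].
Qed.
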